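(* Let $d>1$ be the smallest positive integer, not a multiple of $3$, for which there exists an algebraic number $\alpha$ of degree $d$ over $\mathbb{Q}$ such that some three distinct algebraic conjugates $\alpha_1,\alpha_2,\alpha_3$ of $\alpha$ over $\mathbb{Q}$ satisfy $\alpha_1+\alpha_2+\alpha_3=0$. Then $d=20$.
   Context: The degree of an algebraic number $\alpha$ is the degree of its minimal polynomial over $\mathbb{Q}$. The algebraic conjugates of $\alpha$ are the roots (in $\mathbb{C}$) of this minimal polynomial, including $\alpha$ itself. The assertion includes both that such an algebraic number of degree $20$ exists and that none exists for any degree $1<d<20$ with $3\nmid d$. *)

(* Defs.v *)
From mathcomp Require Import all_boot all_order all_algebra all_field.

Set Implicit Arguments.
Unset Strict Implicit.
Unset Printing Implicit Defensive.

Import GRing.Theory.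

Local Open Scope ring_scope.

(* Algebraic numbers are the elements of [algC]. [minCpoly a] is the monic
   minimal polynomial of [a] over the rationals, viewed in [{poly algC}] (see
   [minCpolyP]). All its complex roots are algebraic, so they all lie in
   [algC]. *)
Definition algdeg (a : algC) : nat := (size (minCpoly a)).-1.

Definition alg_conjugate (a b : algC) : bool := root (minCpoly a) b.

Definition has_zero_sum_conjugates (a : algC) : Prop :=
  exists a1 a2 a3 : algC,
    [/\ [/\ alg_conjugate a a1, alg_conjugate a a2 & alg_conjugate a a3],
        [/\ a1 != a2, a1 != a3 & a2 != a3]
      & a1 + a2 + a3 = 0].

Definition admissible_degree (d : nat) : Prop :=
  [/\ (1 < d)%N, ~~ (3 %| d)%N
    & exists2 a : algC, algdeg a = d & has_zero_sum_conjugates a].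

Definition is_smallest (P : nat -> Prop) (m : nat) : Prop :=
  P m /\ forall n : nat, P n -> (m <= n)%N.

(* Main.v *)
(** For d < 20 with 3 not dividing d we have d = m p^n with m <= 2, p prime,
    p <> 3 and p not dividing m.  Let G be the Galois group acting on the d
    conjugates.  If b1 + b2 + b3 = 0, the integer matrix whose rows are the
    G-translates of e_b1 + e_b2 + e_b3 kills the vector of conjugates, so
    it also has a nonzero kernel vector mod p.  A Sylow p-subgroup P of G acts
    on that kernel, hence fixes a nonzero vector u of it; u is constant on the
    P-orbits, of which there are at most m <= 2 as each has size divisible by
    p^n.  If u is constant, then 3u = 0, a contradiction.  Otherwise every
    translate of the triple meets the first orbit in the same number h of
    points, and averaging over G gives h = 3/2.

    In degree 20, take x_i - x_j with x_i the roots of X^5 - 1/5: up to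
    conjugation this is s(1 - z) with s^5 = 1/5 and z a primitive fifth root of
    unity, a root of X^20 + 25 X^10 + 5, which is Eisenstein at 5; and
    (x_1 - x_2) + (x_2 - x_3) + (x_3 - x_1) = 0. *)
From HB Require Import structures.
Require Import Defs.
From mathcomp Require Import all_boot all_order all_algebra all_field.
From mathcomp Require Import all_fingroup all_solvable.
From mathcomp Require Import ring zify.

Set Implicit Arguments.
Unset Strict Implicit.
Unset Printing Implicit Defensive.

Import Order.TTheory GRing.Theory Num.Theory.

(** * Group actions and linear algebra modulo [p] *)

Local Open Scope group_scope.
Local Open Scope nat_scope.

(** As [K] is a nonzero subspace, [p] divides its order, hence also the number of its [P]-fixed
    vectors. Zero is one of these, so there is another. *)
Lemma pgroup_fixed_ffun (p : nat) (gT : finGroupType) (P : {group gT})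
    (T : finType) (to : {action gT &-> T}) (K : {set {ffun T -> 'F_p}})
    (w : {ffun T -> 'F_p}) :
    prime p -> (p.-group P)%g ->
    (forall c u v, u \in K -> v \in K ->
      [ffun t => u t + c * v t]%R \in K) ->
    (forall g u, g \in P -> u \in K -> [ffun t => u (to t g)] \in K) ->
    w \in K -> w != [ffun=> 0%R] ->
  exists u, [/\ u \in K, u != [ffun=> 0%R]
             & forall g t, g \in P -> u (to t g) = u t].
Proof.
move=> p_pr pP linK stabK Kw w_neq0.
(* Translations by multiples of w act on K without fixed point. *)
pose trans (u : {ffun T -> 'F_p}) (c : 'F_p) := [ffun t => u t + c * w t]%R.
have trans_act : is_action [set: 'F_p] trans.
  apply: is_total_action => [u|u c d].
    by apply/ffunP=> t; rewrite ffunE mul0r addr0.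
  by apply/ffunP=> t; rewrite !ffunE mulrDl addrA.
have dvd_K : p %| #|K|.
  have /(pgroup_fix_mod (to := Action trans_act) (S := K)) :
      (p.-group [set: 'F_p])%g.
    by rewrite /pgroup cardsT card_Fp // pnat_id.
  rewrite (_ : 'Fix_(_ | _)(_) = set0) ?cards0 ?mod0n; last first.
    apply/setP=> u; rewrite inE in_set0; apply/negP=> /andP[_ /afixP fix_u].
    case/eqP: w_neq0; apply/ffunP=> t; rewrite ffunE.
    have /ffunP/(_ t) := fix_u 1%R (in_setT _); rewrite !ffunE mul1r => /eqP.
    by rewrite -subr_eq0 addrAC subrr add0r => /eqP.
  move=> fixK; apply/eqP/fixK; apply/subsetP=> c _.
  by rewrite !inE; apply/subsetP=> u Ku; rewrite inE; apply: linK.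
(* The inverse makes this a right action. *)
pose perm_coord (u : {ffun T -> 'F_p}) g := [ffun t => u (to t g^-1%g)].
have perm_act : is_action [set: gT] perm_coord.
  apply: is_total_action => [u|u g h].
    by apply/ffunP=> t; rewrite ffunE invg1 act1.
  by apply/ffunP=> t; rewrite !ffunE invMg actM.
have K0 : [ffun=> 0%R] \in K.
  have := linK (-1)%R w w Kw Kw; congr (_ \in K); apply/ffunP=> t.
  by rewrite !ffunE mulN1r subrr.
have := pgroup_fix_mod (to := Action perm_act) (S := K) pP.
rewrite (eqP dvd_K) => fixK.
have {}fixK : p %| #|'Fix_(K | Action perm_act)(P)|.
  apply/eqP; rewrite -fixK ?mod0n //; apply/subsetP=> g Pg.
  rewrite !inE; apply/subsetP=> u Ku; rewrite inE; apply: stabK => //.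
  by rewrite groupV.
have : #|'Fix_(K | Action perm_act)(P) :\ [ffun=> 0%R]| != 0.
  have /[!(cardsD1 [ffun=> 0%R] 'Fix_(K | Action perm_act)(P))] := fixK.
  rewrite inE K0 /=.
  have -> : [ffun=> 0%R] \in 'Fix_(Action perm_act)(P).
    by apply/afixP=> g Pg; apply/ffunP=> t; rewrite !ffunE.
  by apply: contraTneq => ->; rewrite addn0 dvdn1 neq_ltn prime_gt1 ?orbT.
rewrite cards_eq0 => /set0Pn[u]; rewrite in_setD1 in_setI.
case/and3P=> u_neq0 Ku /afixP fix_u.
exists u; split=> // g t Pg.
by have /ffunP/(_ (to t g)) := fix_u g Pg; rewrite ffunE actK => ->.
Qed.

(** Orbit-stabilizer in [P] and in [G] gives |orbit| |C_P[t]| = |P| = |S|_p |C_G[t]|_p. Here [p ^ n]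
    divides |S|_p and |C_P[t]| divides |C_G[t]|_p, so |C_P[t]| can be cancelled. *)
Lemma dvdn_orbit_Sylow (p n : nat) (gT : finGroupType) (G P : {group gT})
    (T : finType) (to : {action gT &-> T}) (S : {set T}) t :
    [transitive G, on S | to] -> p.-Sylow(G) P -> prime p -> t \in S ->
  p ^ n %| #|S| -> p ^ n %| #|orbit to P t|.
Proof.
move=> trG sylP p_pr St dvdS; have [sPG pP _] := and3P sylP.
have S_gt0 : 0 < #|S| by apply/card_gt0P; exists t.
have CP_gt0 : 0 < #|'C_P[t | to]| := cardG_gt0 _.
rewrite -(dvdn_pmul2r CP_gt0) card_orbit_stab (card_Hall sylP).
rewrite -(card_orbit_stab to G t) (atransP trG _ St) partnM ?cardG_gt0 //.
apply: dvdn_mul.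
  by rewrite -(@part_pnat_id p (p ^ n)) ?partn_dvd // pnatX pnat_id.
rewrite -(@part_pnat_id p #|'C_P[t | to]|) ?partn_dvd ?cardG_gt0 //.
  by rewrite cardSg // setSI.
by apply: pgroupS pP; apply: subsetIl.
Qed.

(** Double count of the pairs [(t, g)] with [to t g \in A]: by transitivity the count over [g] is
    the same for every [t], and each [g] permutes [T]. *)
Lemma card_transitive_hits (gT : finGroupType) (G : {group gT})
    (T : finType) (to : {action gT &-> T}) (A : {set T}) a :
    [transitive G, on [set: T] | to] ->
  #|T| * \sum_(g in G) (to a g \in A) = #|G| * #|A|.
Proof.
move=> trG; transitivity (\sum_t \sum_(g in G) (to t g \in A)).
  rewrite -sum_nat_const; apply: eq_bigr => t _.
  have /orbitP[h Gh <-] : t \in orbit to G a by rewrite (atransP trG) ?inE.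
  rewrite (reindex_inj (mulgI h)) /=; apply: eq_big => [g|g _].
    by rewrite groupMl.
  by rewrite actM.
rewrite exchange_big /= -sum_nat_const; apply: eq_bigr => g _.
rewrite -sum1_card [RHS]big_mkcond [RHS](reindex_inj (act_inj to g)) /=.
by apply: eq_bigr => t _; case: (_ \in A).
Qed.

(** The combinatorial core: [p != 3] excludes constant invariant vectors, and [m <= 2] bounds the
    number of Sylow orbits. *)
Lemma kernel_triple_eq0 (p n m : nat) (gT : finGroupType) (G : {group gT})
    (T : finType) (to : {action gT &-> T}) (a b c : T) (w : {ffun T -> 'F_p}) :
    prime p -> p != 3 -> m <= 2 -> ~~ (p %| m) -> #|T| = m * p ^ n ->
    [transitive G, on [set: T] | to] ->
    {in G, forall g, w (to a g) + w (to b g) + w (to c g) = 0}%R ->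
  w = [ffun=> 0%R].
Proof.
move=> p_pr p_neq3 le_m2 p'm cardT trG kerw; apply/eqP/negPn/negP=> w_neq0.
pose K := [set u : {ffun T -> 'F_p} |
  [forall g in G, u (to a g) + u (to b g) + u (to c g) == 0]%R].
have KP (u : {ffun T -> 'F_p}) :
    reflect {in G, forall g, u (to a g) + u (to b g) + u (to c g) = 0}%R
            (u \in K).
  by rewrite inE; apply: (iffP forall_inP) => Ku g /Ku /eqP.
have [P sylP] := Sylow_exists p G; have [/subsetP sPG pP _] := and3P sylP.
have [|g u Pg /KP Ku||u [/KP Ku u_neq0 Pu]] :=
  pgroup_fixed_ffun (to := to) (K := K) p_pr pP _ _ _ w_neq0.
- move=> x u v /KP Ku /KP Kv; apply/KP=> g Gg; rewrite !ffunE.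
  rewrite -[RHS](addr0 0)%R -{1}(Ku g Gg) -(mulr0 x) -(Kv g Gg).
  by ring.
- by apply/KP=> h Gh; rewrite !ffunE -!actM Ku // groupM // sPG.
- exact/KP.
have n3_neq0 : (3%:R != 0 :> 'F_p)%R.
  by rewrite -(dvdn_pcharf (pchar_Fp p_pr)) // dvdn_prime2.
have u_orbit t s : s \in orbit to P t -> u s = u t.
  by case/orbitP=> g Pg <-; apply: Pu.
have not_const : ~ (forall t s, u t = u s).
  move=> u_const; case/eqP: u_neq0; apply/ffunP=> t; rewrite ffunE.
  have := Ku 1%g (group1 G); rewrite !act1 -!(u_const t) => u3.
  apply/eqP; have : (3%:R * u t == 0)%R.
    by rewrite -u3 mulr_natl !mulrS addr0 addrA.
  by rewrite mulf_eq0 (negPf n3_neq0).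
have dvd_orb t : p ^ n %| #|orbit to P t|.
  apply: (dvdn_orbit_Sylow trG sylP p_pr); rewrite ?inE //.
  by rewrite cardsT cardT dvdn_mull.
have [s [t u_st]] : exists s t, u s != u t.
  case: (pickP [pred st | u st.1 != u st.2]) => [[s t] /= ?|u_const].
    by exists s, t.
  case: not_const => t s; apply/eqP/negbFE; exact: (u_const (t, s)).
have disj : [disjoint orbit to P s & orbit to P t].
  apply/pred0Pn=> -[r /andP[/= /u_orbit rs /u_orbit rt]].
  by case/eqP: u_st; rewrite -rs.
have card_orb r : p ^ n <= #|orbit to P r|.
  by rewrite dvdn_leq //; apply/card_gt0P; exists r; apply: orbit_refl.
have cardU : #|orbit to P s :|: orbit to P t| = #|orbit to P s| + #|orbit to P t|.
  by apply/eqP; rewrite (leq_card_setU _ _).2.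
have cardU_le : #|orbit to P s :|: orbit to P t| <= m * p ^ n.
  by rewrite -cardT max_card.
have pn_gt0 : 0 < p ^ n by rewrite expn_gt0 prime_gt0.
(* Two disjoint orbits of at least [p ^ n] points each must fill a set of at most [2 * p ^ n]
   points. *)
have [m2 cardO cardO'] :
    [/\ m = 2, #|orbit to P s| = p ^ n & #|orbit to P t| = p ^ n].
  move: (card_orb s) (card_orb t) cardU_le pn_gt0 le_m2; rewrite cardU.
  move: #|orbit to P s| #|orbit to P t| (p ^ n) => x y q; clear.
  by case: m => [|[|[|//]]] => le_x le_y le_q q_gt0 _; split; lia.
have u_val r : (u r = u t + (r \in orbit to P s)%:R * (u s - u t))%R.
  have [/u_orbit -> | r'Os] := boolP (r \in orbit to P s).
    by rewrite mul1r addrC subrK.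
  rewrite mul0r addr0 (u_orbit t) //.
  have : r \in orbit to P s :|: orbit to P t.
    suff /eqP-> : orbit to P s :|: orbit to P t == [set: T] by rewrite inE.
    rewrite eqEcard subsetT cardsT cardT cardU m2 cardO cardO'.
    by rewrite mul2n addnn leqnn.
  by rewrite in_setU (negPf r'Os).
pose hits g := (to a g \in orbit to P s) + (to b g \in orbit to P s)
  + (to c g \in orbit to P s).
have sumE (R : comNzRingType) (x y z v d : R) :
    (v + x * d + (v + y * d) + (v + z * d) = (x + y + z) * d + 3%:R * v)%R.
  by ring.
(* The right-hand side is independent of [g], so the residue of [hits g] mod [p] is too. *)
have hitsE g : g \in G -> ((hits g)%:R * (u s - u t) = - (3%:R * u t))%R.
  move=> /Ku; rewrite (u_val (to a g)) (u_val (to b g)) (u_val (to c g)).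
  rewrite sumE -!natrD => /eqP.
  by rewrite addr_eq0 => /eqP.
(* Not dividing [m = 2] and differing from 3, [p] is at least 5; so [hits g], which is at most 3, is
   determined by its residue. *)
have p_gt4 : 4 < p.
  have := prime_gt1 p_pr; move: p_pr p_neq3 p'm; rewrite m2.
  by case: (p) => [|[|[|[|[|]]]]].
have hits_const g : g \in G -> hits g = hits 1%g.
  move=> Gg; have hits_lt h : hits h < p.
    by rewrite /hits; move: p_gt4; do 3!case: (_ \in _); apply: leq_trans.
  rewrite -(modn_small (hits_lt g)) -(modn_small (hits_lt 1%g)) -!val_Fp_nat //.
  congr (nat_of_ord _); have u_neq : (u s - u t != 0)%R by rewrite subr_eq0.
  by apply: (mulIf u_neq); rewrite !hitsE.
have : #|T| * \sum_(g in G) hits g = 3 * #|G| * p ^ n.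
  rewrite !big_split /= !mulnDr !(card_transitive_hits _ _ trG) cardO.
  by rewrite -!mulnDl -mulnA !mulSn mul0n addn0 !addnA !mulnDl.
rewrite (eq_bigr _ hits_const) sum_nat_const cardT m2.
have G_gt0 : 0 < #|G| by apply: cardG_gt0.
rewrite mulnC -!mulnA (mulnCA 3) => /eqP.
rewrite eqn_pmul2l // !mulnA eqn_pmul2r //.
(* What remains after cancellation is [hits 1%g * 2 = 3]. *)
by move=> /eqP/(congr1 odd); rewrite oddM andbF.
Qed.

(** The rank of an integer matrix can only drop on reduction mod [p], so a nontrivial kernel in
    characteristic 0 survives. *)
Lemma kernel_mod_p (p : nat) (F : numFieldType) (I J : finType)
    (A : I -> J -> nat) (v : J -> F) j0 :
    prime p -> (v j0 != 0)%R ->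
    (forall i, \sum_j (A i j)%:R * v j = 0)%R ->
  exists2 u : {ffun J -> 'F_p}, u != [ffun=> 0%R]
    & forall i, (\sum_j (A i j)%:R * u j = 0)%R.
Proof.
move=> p_pr v_neq0 kerv.
pose M (R : nzRingType) := (\matrix_(i < #|I|, j < #|J|)
  (A (enum_val i) (enum_val j))%:R : 'M[R]_(_, _))%R.
have Mint (R : nzRingType) : M R = map_mx intr (M int).
  by apply/matrixP=> i j; rewrite !mxE rmorph_nat.
have sumE (R : nzRingType) (x : J -> R) :
    (\sum_j x j = \sum_(j < #|J|) x (enum_val j))%R.
  exact: (reindex _ (onW_bij _ (@enum_val_bij J))).
have Mcol (R : nzRingType) (x : J -> R) :
    (forall i, \sum_j (A i j)%:R * x j = 0)%R <->
    (M R *m (\col_j x (enum_val j)) = 0)%R.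
  split=> [kerx | kerx i].
    apply/colP=> i; rewrite !mxE -[RHS](kerx (enum_val i)) [RHS]sumE.
    by apply: eq_bigr => j _; rewrite !mxE.
  have /colP/(_ (enum_rank i)) := kerx; rewrite !mxE => kerxi.
  rewrite -[RHS]kerxi sumE.
  by apply: eq_bigr => j _; rewrite !mxE enum_rankK.
(* If M has full rank mod p, some maximal minor is nonzero mod p, hence in F. *)
have [fullM|] := boolP (row_full (M 'F_p)).
  set f := fullrankfun fullM; have := fullrowsub_unit fullM.
  rewrite -/f unitmxE Mint -map_mxsub det_map_mx unitfE => det_p.
  have det_F : (\det (map_mx intr (rowsub f (M int))) != 0 :> F)%R.
    rewrite det_map_mx intr_eq0; apply: contraNneq det_p => ->.
    by rewrite rmorph0.
  have unitF : (rowsub f (M F) \in unitmx)%R.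
    by rewrite unitmxE Mint -map_mxsub unitfE.
  have /Mcol kerF := kerv; case/eqP: v_neq0.
  suff col0 : (\col_j v (enum_val j) = 0 :> 'cV[F]_#|J|)%R.
    by have /colP/(_ (enum_rank j0)) := col0; rewrite !mxE enum_rankK.
  rewrite -(mulKmx unitF (\col_j _)%R) mul_rowsub_mx kerF.
  by rewrite mxsub_const mulmx0.
(* The rank is below the number of columns, so the transpose has a nonzero left kernel vector. *)
rewrite /row_full -mxrank_tr -[_ == _]/(row_free _) -kermx_eq0.
case/rowV0Pn=> x /sub_kermxP xM x_neq0.
exists [ffun j => x 0%R (enum_rank j)].
  apply: contra_neq x_neq0 => /ffunP x0; apply/rowP=> j.
  by have := x0 (enum_val j); rewrite !ffunE mxE enum_valK.
apply/Mcol; apply: trmx_inj; rewrite trmx_mul trmx0 -[RHS]xM; congr (_ *m _)%R.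
by apply/rowP=> j; rewrite !mxE ffunE enum_valK.
Qed.

(** * The Galois action on the conjugates *)

Local Open Scope ring_scope.

(** Both sides come from monic rational polynomials vanishing at the element, and by minimality each
    divides the other. *)
Lemma minCpoly_minPoly (L : fieldExtType rat) (iota : {rmorphism L -> algC}) x :
  minCpoly (iota x) = map_poly iota (minPoly 1 x).
Proof.
have algE (q : {poly rat}) :
    map_poly iota (map_poly (in_alg L) q) = map_poly ratr q.
  rewrite -map_poly_comp; apply: eq_map_poly => c.
  by rewrite /= alg_num_field fmorph_rat.
have [q [-> q_monic] dvd_q] := minCpolyP (iota x).
have /polyOver1P[r r_def] := minPolyOver 1 x.
have r_monic : r \is monic.
  by rewrite -(map_monic (in_alg L)) -r_def monic_minPoly.
rewrite r_def algE; congr map_poly; apply/eqP; rewrite -eqp_monic //.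
apply/andP; split; first by rewrite -dvd_q -algE fmorph_root -r_def root_minPoly.
rewrite -(dvdp_map (in_alg L)) -r_def minPoly_dvdp //.
  by apply/polyOver1P; exists q.
by rewrite -(fmorph_root iota) algE dvd_q.
Qed.

(** The number field generated by all roots of [minCpoly a] is a splitting field, and [a] is one of
    those roots. *)
Lemma galois_hull_exists (a : algC) :
  exists (L : splittingFieldType rat) (iota : {rmorphism L -> algC}) (x : L),
    iota x = a.
Proof.
have [r Dr] := closed_field_poly_normal (minCpoly a).
have [L [iota [r1 Dr1 genL]]] := num_field_exists r.
move: Dr; rewrite (monicP (minCpoly_monic a)) scale1r => Dr.
have [q [Dq _] _] := minCpolyP a.
have L_ax : FieldExt_isSplittingField _ L.
  constructor; exists (map_poly (in_alg L) q); first by apply/polyOver1P; exists q.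
  exists r1; last exact: genL.
  rewrite (_ : map_poly _ _ = \prod_(z <- r1) ('X - z%:P)) ?eqpxx //.
  apply: (map_poly_inj iota); rewrite rmorph_prod /= -map_poly_comp.
  transitivity (minCpoly a).
    rewrite Dq; apply: eq_map_poly => c.
    by rewrite /= alg_num_field fmorph_rat.
  rewrite Dr -Dr1 big_map; apply: eq_bigr => z _.
  by rewrite map_polyXsubC.
have : root (minCpoly a) a := root_minCpoly a.
rewrite Dr root_prod_XsubC -Dr1 => /mapP[x _ ->].
by exists (HB.pack_for (splittingFieldType rat) L L_ax), iota, x.
Qed.

Lemma sum_triple_neq0 (p n m : nat) (a b1 b2 b3 : algC) :
    prime p -> p != 3%N -> (m <= 2)%N -> ~~ (p %| m)%N ->
    algdeg a = (m * p ^ n)%N ->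
    alg_conjugate a b1 -> alg_conjugate a b2 -> alg_conjugate a b3 ->
    b1 != b2 ->
  b1 + b2 + b3 != 0.
Proof.
move=> p_pr p_neq3 le_m2 p'm deg_a; rewrite /alg_conjugate.
have [L [iota [x Dx]]] := galois_hull_exists a.
have galL : galois 1 {:L}.
  rewrite /galois sub1v normalFieldf andbT.
  apply/separableP=> y _; apply: pcharf0_separable => q.
  by rewrite pchar_lalg pchar_num.
have inGal (g : gal_of {:L}) : g \in 'Gal({:L} / 1)%g.
  rewrite gal_kHom ?sub1v //; apply/kAHomP=> _ /vlineP[c ->].
  by rewrite linearZ /= rmorph1.
have /(galois_factors (sub1v _))/(_ x (memvf x))[r0 [_]] := galL.
set r := map _ _ => r_uniq Dmin.
have rP y : (y \in r) = root (minPoly 1 x) y by rewrite Dmin root_prod_XsubC.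
have gal_r (g : gal_of {:L}) (y : seq_sub r) : g (val y) \in r.
  have := valP y; rewrite !rP => root_y.
  have [h _ <-] :=
    normalField_root_minPoly (sub1v {:L}) (normalFieldf 1) (memvf x) root_y.
  by rewrite -galM ?memvf // root_minPoly_gal ?sub1v ?memvf.
pose galact (y : seq_sub r) g := SeqSub (gal_r g y).
have galact_act : is_action [set: gal_of {:L}] galact.
  apply: is_total_action => [y|y g h]; apply: val_inj.
    by rewrite /= gal_id.
  by rewrite /= galM ?memvf.
pose to := Action galact_act.
have card_r : #|{: seq_sub r}| = (m * p ^ n)%N.
  rewrite card_seq_sub // -deg_a /algdeg -Dx minCpoly_minPoly size_map_poly.
  by rewrite Dmin size_prod_XsubC.
have conjP b : root (minCpoly a) b -> exists y : seq_sub r, iota (val y) = b.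
  rewrite -Dx minCpoly_minPoly Dmin rmorph_prod.
  rewrite (eq_bigr _ (fun z _ => map_polyXsubC iota z)).
  rewrite -(big_map iota xpredT (fun z => 'X - z%:P)) root_prod_XsubC.
  by case/mapP=> y ry ->; exists (SeqSub ry).
move=> /conjP[y1 <-] /conjP[y2 <-] /conjP[y3 <-] y12.
apply/negP=> /eqP y123.
have sum_y : val y1 + val y2 + val y3 = 0.
  by apply: (fmorph_inj iota); rewrite !rmorphD rmorph0.
(* Row [g] is the sum of the indicators of the three translated points, so its product with a vector
   adds three entries. *)
pose A g t := ((t == to y1 g) + (t == to y2 g) + (t == to y3 g))%N.
have sumA (R : nzRingType) (f : seq_sub r -> R) g :
    \sum_t (A g t)%:R * f t = f (to y1 g) + f (to y2 g) + f (to y3 g).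
  have sum1 s : \sum_t (t == s)%:R * f t = f s.
    rewrite (bigD1 s) //= eqxx mul1r big1 ?addr0 // => t /negPf->.
    by rewrite mul0r.
  rewrite -[in RHS]sum1 -(sum1 (to y2 g)) -(sum1 (to y3 g)) -!big_split /=.
  by apply: eq_bigr => t _; rewrite !natrD !mulrDl.
(* Two distinct conjugates cannot both be 0, so the vector of conjugates is nonzero. *)
have [y0 y0_neq0] : exists y : seq_sub r, iota (val y) != 0.
  have [y1_0|] := eqVneq (iota (val y1)) 0; last by exists y1.
  by exists y2; rewrite -y1_0 eq_sym.
have [g|u u_neq0 keru] :=
  @kernel_mod_p p _ _ _ A (fun y => iota (val y)) y0 p_pr y0_neq0.
  by rewrite sumA /= -!rmorphD sum_y !rmorph0.
case/eqP: u_neq0.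
apply: (kernel_triple_eq0 (to := to) (G := [group of [set: gal_of {:L}]])
          (a := y1) (b := y2) (c := y3) p_pr p_neq3 le_m2 p'm card_r).
  (* Transitivity: every root is a Galois image of [x], so [h1^-1 * h] carries [y1] to [y] through
     [x]. *)
  apply/imsetP; exists y1; first by rewrite inE.
  apply/esym/eqP; rewrite -subTset; apply/subsetP=> y _.
  have := valP y1; have := valP y; rewrite !rP => root_y root_y1.
  have [h _ hx] :=
    normalField_root_minPoly (sub1v {:L}) (normalFieldf 1) (memvf x) root_y.
  have [h1 _ h1x] :=
    normalField_root_minPoly (sub1v {:L}) (normalFieldf 1) (memvf x) root_y1.
  apply/orbitP; exists (h1^-1 * h)%g; first by rewrite inE.
  apply: val_inj; rewrite /= -h1x -galM ?memvf // mulKVg hx.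
  by [].
by move=> g _; rewrite -sumA.
Qed.

(** * The example in degree 20 *)

(** Eisenstein makes [q] irreducible over the integers, hence over the rationals; the nonconstant
    minimal polynomial divides it, and both are monic. *)
Lemma Eisenstein_minCpoly (p : nat) (q : {poly int}) (a : algC) :
    prime p -> q \is monic -> ~~ (p ^+ 2 %| q`_0)%Z ->
    (forall i, (i < (size q).-1)%N -> (p %| q`_i)%Z) ->
    root (map_poly intr q) a ->
  minCpoly a = map_poly intr q.
Proof.
move=> p_pr q_monic p2'q0 p_q qa.
have qE : map_poly intr q = map_poly ratr (map_poly intr q) :> {poly algC}.
  by rewrite -map_poly_comp; apply: eq_map_poly => c; rewrite /= ratr_int.
have [r [Dr r_monic] dvd_r] := minCpolyP a.
have q_neq1 : size q != 1.
  apply: contraTneq qa => /eqP/size_poly1P[c _ Dq].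
  move: q_monic; rewrite Dq monicE lead_coefC => /eqP->.
  by rewrite map_polyC rootC oner_eq0.
have /irreducible_rat_int[_ q_irr] : irreducible_poly q.
  apply: (eisenstein_crit p_pr) => //.
  by rewrite (monicP q_monic) dvdz1 absz_nat gtn_eqF ?prime_gt1.
rewrite Dr qE; congr map_poly; apply/eqP.
have q_rat_monic : map_poly intr q \is @monic rat.
  by rewrite monicE lead_coef_map_inj ?(monicP q_monic) //; apply: intr_inj.
rewrite -eqp_monic //; apply: q_irr; last by rewrite -dvd_r -qE.
by rewrite -(size_map_poly (ratr : rat -> algC)) -Dr neq_ltn size_minCpoly orbT.
Qed.

Definition eisenstein20 : {poly int} := 'X^20 + (25%:P * 'X^10 + 5%:P).

Lemma size_eisenstein20_low : (size (25%:P * 'X^10 + 5%:P : {poly int})%R < 21)%N.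
Proof.
rewrite (leq_ltn_trans (size_polyD _ _)) // gtn_max mul_polyC.
by rewrite (leq_ltn_trans (size_scale_leq _ _)) ?size_polyXn // size_polyC.
Qed.

Lemma size_eisenstein20 : size eisenstein20 = 21.
Proof. by rewrite size_polyDl size_polyXn ?size_eisenstein20_low. Qed.

Lemma eisenstein20_minCpoly (a : algC) :
  a ^+ 20 + 25%:R * a ^+ 10 + 5%:R = 0 -> minCpoly a = map_poly intr eisenstein20.
Proof.
move=> a_root; apply: (@Eisenstein_minCpoly 5) => //.
- rewrite monicE /eisenstein20 lead_coefDl ?lead_coefXn //.
  by rewrite size_polyXn size_eisenstein20_low.
- by rewrite /eisenstein20 !coefE.
- move=> i; rewrite size_eisenstein20 /= => i_lt.
  rewrite /eisenstein20 !coefE (ltn_eqF i_lt) add0r.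
  by case: (i == 10)%N; case: (i == 0)%N.
rewrite /root (_ : map_poly _ _ = 'X^20 + (25%:R%:P * 'X^10 + 5%:R%:P)).
  by rewrite !hornerD hornerCM !hornerXn !hornerC addrA a_root.
by rewrite /eisenstein20 !mul_polyC !rmorphD /= map_polyZ !map_polyXn map_polyC.
Qed.

(** Only the cyclotomic relation is asked of [w], so the same computation serves [w = z] and
    [w = z ^+ 2]. *)
Lemma eisenstein20_root (R : comNzRingType) (s w : R) :
    s ^+ 5 * 5%:R = 1 -> 1 + w + w ^+ 2 + w ^+ 3 + w ^+ 4 = 0 ->
  let x := s * (1 - w) in x ^+ 20 + 25%:R * x ^+ 10 + 5%:R = 0.
Proof.
move=> s5 Phi5 x.
have w5 : w ^+ 5 = 1.
  apply/eqP; rewrite -subr_eq0; apply/eqP; rewrite -[RHS](mulr0 (w - 1)) -Phi5.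
  by ring.
(* Modulo [w ^+ 5 = 1], the binomial expansion of [(1 - w) ^+ 5] is [5 c]. *)
pose c := - w + 2%:R * w ^+ 2 - 2%:R * w ^+ 3 + w ^+ 4.
have x5 : x ^+ 5 = c.
  transitivity (s ^+ 5 * 5%:R * c + s ^+ 5 * (1 - w ^+ 5)).
    by rewrite /x /c; ring.
  by rewrite s5 w5; ring.
(* The cofactor is the quotient of c^4 + 25 c^2 + 5 by 1 + w + w^2 + w^3 + w^4. *)
rewrite (exprM x 5 4) (exprM x 5 2) x5 -[RHS](mulr0 (5%:R - 5%:R * w
  + 25%:R * w ^+ 2 - 125%:R * w ^+ 3 + 301%:R * w ^+ 4 - 454%:R * w ^+ 5
  + 485%:R * w ^+ 6 - 391%:R * w ^+ 7 + 244%:R * w ^+ 8 - 116%:R * w ^+ 9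
  + 40%:R * w ^+ 10 - 9%:R * w ^+ 11 + w ^+ 12)) -Phi5 /c.
by ring.
Qed.

Lemma admissible_degree20 : admissible_degree 20.
Proof.
have [z z_prim] := C_prim_root_exists (isT : 0 < 5)%N.
have z5 := prim_expr_order z_prim.
have z_neq1 k : (0 < k < 5)%N -> z ^+ k != 1.
  move=> k_lt; rewrite -(prim_order_dvd z_prim) gtnNdvd //; by case/andP: k_lt.
have Phi5 (w : algC) : w ^+ 5 = 1 -> w != 1 ->
    1 + w + w ^+ 2 + w ^+ 3 + w ^+ 4 = 0.
  move=> w5 w_neq1; apply/eqP; have := subrr (w ^+ 5); rewrite {2}w5.
  have -> : w ^+ 5 - 1 = (w - 1) * (1 + w + w ^+ 2 + w ^+ 3 + w ^+ 4) by ring.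
  by move/eqP; rewrite mulf_eq0 subr_eq0 (negPf w_neq1).
pose s : algC := 5.-root (5%:R^-1).
have s5 : s ^+ 5 * 5%:R = 1 by rewrite rootCK // mulVf ?pnatr_eq0.
have s_neq0 : s != 0.
  by apply: contra_eq_neq s5 => ->; rewrite expr0n mul0r eq_sym oner_eq0.
have z_root : minCpoly (s * (1 - z)) = map_poly intr eisenstein20.
  apply/eisenstein20_minCpoly/eisenstein20_root => //.
  by apply: Phi5 => //; have := z_neq1 1%N isT.
have conjP b : b ^+ 20 + 25%:R * b ^+ 10 + 5%:R = 0 ->
    alg_conjugate (s * (1 - z)) b.
  move=> /eisenstein20_minCpoly b_root.
  by rewrite /alg_conjugate z_root -b_root root_minCpoly.
split=> //; exists (s * (1 - z)).
  rewrite /algdeg z_root size_map_poly_id0 ?size_eisenstein20 //.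
  by rewrite intr_eq0 lead_coef_eq0 -size_poly_eq0 size_eisenstein20.
(* These are the cyclic differences of [s], [s * z] and [s * z ^+ 2]. *)
exists (s * (1 - z)), (s * (1 - z) * z), (- (s * (1 - z ^+ 2))); split.
- have root1 : (s * (1 - z)) ^+ 20 + 25%:R * (s * (1 - z)) ^+ 10 + 5%:R = 0.
    by apply: eisenstein20_root => //; apply: Phi5 => //; have := z_neq1 1%N isT.
  (* Only the powers 20 and 10 occur, so multiplication by [z] or by -1 preserves the roots. *)
  split; apply: conjP => //.
    rewrite (exprMn 20) (exprMn 10) (exprM z 5 4) (exprM z 5 2) z5 !expr1n !mulr1.
    exact: root1.
  have -> (y : algC) : (- y) ^+ 20 + 25%:R * (- y) ^+ 10 = y ^+ 20 + 25%:R * y ^+ 10.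
    by ring.
  apply: eisenstein20_root => //; apply: Phi5; last exact: z_neq1.
  by rewrite exprAC z5 expr1n.
- have z1_neq0 : 1 - z != 0 by rewrite subr_eq0 eq_sym; have := z_neq1 1%N isT.
  have mulI := mulfI (mulf_neq0 s_neq0 z1_neq0).
  (* Divided by [s * (1 - z)], the three numbers are 1, [z] and [- 1 - z]. A coincidence with the
     last gives [z = -2] or [2 z = -1], and fifth powers then yield 33 = 0. *)
  have -> : - (s * (1 - z ^+ 2)) = s * (1 - z) * (- 1 - z) by ring.
  rewrite -{1 3}[s * (1 - z)]mulr1 !(inj_eq mulI); split.
  + by rewrite eq_sym; have := z_neq1 1%N isT.
  + apply/eqP=> z2; have Dz : z = - 2%:R by rewrite -[LHS](subKr (- 1)) -z2; ring.
    have /eqP : 33%:R = 0 :> algC by rewrite -(subrr (z ^+ 5)) {1}z5 Dz; ring.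
    by rewrite pnatr_eq0.
  apply/eqP=> z2; have Dz : 2%:R * z = - 1 by rewrite mulr_natl mulr2n {1}z2 subrK.
  have /eqP : 33%:R = 0 :> algC.
    transitivity (2%:R ^+ 5 * z ^+ 5 + 1); first by rewrite z5; ring.
    by rewrite -exprMn Dz; ring.
  by rewrite pnatr_eq0.
by ring.
Qed.

Theorem theorem1 (d : nat) : is_smallest admissible_degree d <-> d = 20%N.
Proof.
have lower n : admissible_degree n -> (20 <= n)%N.
  case=> n_gt1 n_3 [a deg_a [b1 [b2 [b3 [[cb1 cb2 cb3] [b12 _ _] b123]]]]].
  rewrite leqNgt; apply/negP=> n_lt20.
  have absurd p k m : prime p -> p != 3%N -> (m <= 2)%N -> ~~ (p %| m)%N ->
      n = (m * p ^ k)%N -> False.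
    move=> p_pr p_neq3 le_m2 p'm Dn; rewrite Dn in deg_a.
    have := sum_triple_neq0 p_pr p_neq3 le_m2 p'm deg_a cb1 cb2 cb3 b12.
    by rewrite b123 eqxx.
  have prime_absurd : prime n -> n != 3%N -> False.
    move=> n_pr n_neq3; apply: (absurd n 1%N 1%N); rewrite ?expn1 ?mul1n //.
    by rewrite dvdn1 gtn_eqF // prime_gt1.
  have pow2_absurd k : n = (2 ^ k)%N -> False.
    by move=> Dn; apply: (absurd 2 k 1%N); rewrite ?mul1n.
  have twice_absurd p : prime p -> (4 < p)%N -> n = (2 * p)%N -> False.
    move=> p_pr p_gt4 Dn; apply: (absurd p 1%N 2); rewrite ?expn1 //.
      by rewrite gtn_eqF // (leq_trans _ p_gt4).
    by rewrite gtnNdvd // (leq_trans _ p_gt4).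
  (* The degrees left are the primes other than 3, the powers 4, 8, 16 of 2, and 10 and 14. *)
  move: n_gt1 n_3 n_lt20 prime_absurd pow2_absurd twice_absurd.
  case: (n) => [|[|[|[|[|[|[|[|[|[|[|[|[|[|[|[|[|[|[|[|]]]]]]]]]]]]]]]]]]]] //
      _ _ _ prime_absurd pow2_absurd twice_absurd;
    solve [exact: prime_absurd | exact: (pow2_absurd 2) | exact: (pow2_absurd 3)
      | exact: (pow2_absurd 4) | exact: (twice_absurd 5) | exact: (twice_absurd 7)].
split=> [[adm_d min_d] | ->]; last by split; first exact: admissible_degree20.
by apply/eqP; rewrite eqn_leq min_d ?lower //; apply: admissible_degree20.
Qed.
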